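(* Let $r\ge 4$ and let $G$ be a $K_r^{=}$-minor free graph on $n$ vertices. Suppose $A,B\subseteq V(G)$ are disjoint sets with $|A|=r-3$, $|B|=(1-\delta)n$ and $(1-2\delta)n>r$ (for some $\delta\ge 0$), such that $A$ induces a complete graph in $G$ and every vertex of $A$ is adjacent to every vertex of $B$ (i.e. $G$ contains the complete split graph $S_{|A\cup B|,|A|}$ with clique part $A$ and independent part $B$ as a subgraph). For any $u\in V(G)\setminus(A\cup B)$, let $$G^*=G-\{uv: v\in N_G(u)\}+\{uv: v\in A\}.$$ Then $G^*$ is $K_r^{=}$-minor free.
   Context: All graphs are finite and simple; $N_G(u)$ is the neighborhood of $u$. $G-M$ denotes deleting the edge set $M$ and $G+M'$ adding the edge set $M'$. $S_{m,t}=K_t\nabla\overline{K}_{m-t}$ is the join of a clique on $t$ vertices with an independent set on $m-t$ vertices. $K_r^{=}$ is the graph obtained from $K_r$ by deleting two edges sharing a common vertex. A graph $H$ is a minor of $G$ if $H$ can be obtained from $G$ by vertex deletions, edge deletions and edge contractions; $G$ is $H$-minor free if it has no $H$ minor. *)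

(* Defs.v *)
From mathcomp Require Import all_boot.

Set Implicit Arguments.
Unset Strict Implicit.
Unset Printing Implicit Defensive.

Record sgraph := SGraph {
  svertex :> finType;
  adj : rel svertex;
  adj_sym : symmetric adj;
  adj_irrefl : irreflexive adj
}.

Notation "x -- y" := (adj x y) (at level 30, no associativity).

Definition neighborhood (G : sgraph) (u : G) : {set G} := [set v | u -- v].

Definition sgraph_iso (G H : sgraph) : Prop :=
  exists2 f : G -> H, bijective f & forall x y, (f x -- f y) = (x -- y).

(* Edges are unordered pairs [set x; y], so a set of edges is a {set {set G}}. *)

Section EdgeOperations.
Variables (G : sgraph) (M : {set {set G}}).

Definition del_edges_rel (x y : G) := (x -- y) && ([set x; y] \notin M).

Lemma del_edges_sym : symmetric del_edges_rel.
Proof. by move=> x y; rewrite /del_edges_rel adj_sym setUC. Qed.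

Lemma del_edges_irrefl : irreflexive del_edges_rel.
Proof. by move=> x; rewrite /del_edges_rel adj_irrefl. Qed.

Definition del_edges := SGraph del_edges_sym del_edges_irrefl.

(* Singletons [set x] = [set x; x] in M are ignored: no loop is created. *)
Definition add_edges_rel (x y : G) :=
  (x != y) && ((x -- y) || ([set x; y] \in M)).

Lemma add_edges_sym : symmetric add_edges_rel.
Proof. by move=> x y; rewrite /add_edges_rel adj_sym setUC eq_sym. Qed.

Lemma add_edges_irrefl : irreflexive add_edges_rel.
Proof. by move=> x; rewrite /add_edges_rel eqxx. Qed.

Definition add_edges := SGraph add_edges_sym add_edges_irrefl.
End EdgeOperations.

Section VertexDeletion.
Variables (G : sgraph) (w : G).

Definition del_vertex_rel (x y : {z : G | z != w}) := val x -- val y.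

Lemma del_vertex_sym : symmetric del_vertex_rel.
Proof. by move=> x y; rewrite /del_vertex_rel adj_sym. Qed.

Lemma del_vertex_irrefl : irreflexive del_vertex_rel.
Proof. by move=> x; rewrite /del_vertex_rel adj_irrefl. Qed.

Definition del_vertex := SGraph del_vertex_sym del_vertex_irrefl.
End VertexDeletion.

(* Contraction of the edge ab: b is removed and a plays the role of the merged
   vertex, inheriting the neighbours of b; loops and multiple edges vanish. *)
Section Contraction.
Variables (G : sgraph) (a b : G).

Definition contract_rel (x y : {z : G | z != b}) :=
  (x != y) && [|| val x -- val y,
                  (val x == a) && (b -- val y)
                | (val y == a) && (b -- val x)].

Lemma contract_sym : symmetric contract_rel.
Proof.
move=> x y; rewrite /contract_rel eq_sym adj_sym; congr (_ && (_ || _)).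
exact: orbC.
Qed.

Lemma contract_irrefl : irreflexive contract_rel.
Proof. by move=> x; rewrite /contract_rel eqxx. Qed.

Definition contract := SGraph contract_sym contract_irrefl.
End Contraction.

Inductive minor (H : sgraph) : sgraph -> Prop :=
| minor_iso (G : sgraph) : sgraph_iso G H -> minor H G
| minor_del_vertex (G : sgraph) (w : G) : minor H (del_vertex w) -> minor H G
| minor_del_edge (G : sgraph) (a b : G) :
    a -- b -> minor H (del_edges [set [set a; b]]) -> minor H G
| minor_contract (G : sgraph) (a b : G) :
    a -- b -> minor H (contract a b) -> minor H G.

Definition minor_free (H G : sgraph) : Prop := ~ minor H G.

Section Complete.
Variable r : nat.

Definition complete_rel (i j : 'I_r) := i != j.

Lemma complete_sym : symmetric complete_rel.
Proof. by move=> i j; rewrite /complete_rel eq_sym. Qed.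

Lemma complete_irrefl : irreflexive complete_rel.
Proof. by move=> i; rewrite /complete_rel eqxx. Qed.

Definition complete := SGraph complete_sym complete_irrefl.
End Complete.

(* K_r minus the two edges {0, 1} and {0, 2}; meaningful for r >= 3. *)
Definition complete_minus2 (r : nat) : sgraph :=
  @del_edges (complete r)
    [set [set i; j] | i in [set i : 'I_r | i == 0 :> nat],
                      j in [set j : 'I_r | (j == 1 :> nat) || (j == 2 :> nat)]].

Definition rewire (G : sgraph) (u : G) (A : {set G}) : sgraph :=
  @add_edges (del_edges [set [set u; v] | v in neighborhood u])
    [set [set u; v] | v in A].

(* Main.v *)
(* [K_r^=] is the join of [K_(r-3)] with the disjoint union of a vertex and an
   edge. As [G] has no such minor, a vertex of [B] with a neighbour [w] outside
   [A] forces [w] outside [B], and [w] has no other neighbour in [B]: otherwise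
   a third vertex of [B] would complete the minor. So at most [|V \ B|] vertices
   of [B] have a neighbour outside [A], and more than [r] vertices of [B] have
   neighbourhood exactly [A], just like [u] in [G*]. In a [K_r^=] minor model of
   [G*], one of these twins is unused or shares its branch set with another
   twin; it can be freed and substituted for [u], giving a model in [G]. *)
Require Import Defs.
From mathcomp Require Import all_boot all_order all_algebra.
From mathcomp Require Import zify lra.

Import Order.TTheory GRing.Theory Num.Theory.
Local Open Scope ring_scope.

(** * Minor models and their equivalence with minors *)

(* Each nonempty fibre [phi x = Some h] is connected: a property that propagates
   along the edges inside fibres is constant on every fibre. *)
Definition class_connected (G : sgraph) (T : Type) (phi : G -> option T) : Prop :=
  forall P : G -> Prop,
    (forall x y h, phi x = Some h -> phi y = Some h -> x -- y -> P x -> P y) ->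
    forall x y h, phi x = Some h -> phi y = Some h -> P x -> P y.

(* The branch set of [h] is the fibre [phi x = Some h]; vertices sent to [None]
   are deleted. *)
Definition minor_model (H G : sgraph) (phi : G -> option H) : Prop :=
  [/\ forall h, exists x, phi x = Some h,
      class_connected G H phi &
      forall h k, h -- k -> exists x y, [/\ phi x = Some h, phi y = Some k & x -- y]].

(** The hypotheses make each fibre of [psi] the exact image under [rho] of the corresponding fibre
    of [phi], so connectedness and edges are pushed forward. An edge between two branch sets cannot
    collapse, because [psi] keeps their labels distinct. *)
Lemma minor_model_map (H G G' : sgraph) (phi : G -> option H)
    (psi : G' -> option H) (rho : G -> G') :
  minor_model H G phi ->
  (forall x h, phi x = Some h -> psi (rho x) = Some h) ->
  (forall x y h k, phi x = Some h -> phi y = Some k -> x -- y ->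
     rho x = rho y \/ rho x -- rho y) ->
  (forall y h, psi y = Some h -> exists2 x, phi x = Some h & rho x = y) ->
  minor_model H G' psi.
Proof.
case=> surj conn edge psiE homo im; split.
- by move=> h; have [x xh] := surj h; exists (rho x); exact: psiE.
- move=> P step x y h /im [x' x'h <-] /im [y' y'h <-].
  apply: (conn (fun z => P (rho z))) x'h y'h => s t k sk tk st Ps.
  have [<- //|st'] := homo _ _ _ _ sk tk st.
  exact: (step (rho s) (rho t) k (psiE _ _ sk) (psiE _ _ tk) st' Ps).
- move=> h k hk; have [x [y [xh yk xy]]] := edge h k hk.
  exists (rho x), (rho y); split; [exact: psiE | exact: psiE |].
  have [E|//] := homo _ _ _ _ xh yk xy.
  have := psiE _ _ xh; rewrite E (psiE _ _ yk) => -[E'].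
  by rewrite E' adj_irrefl in hk.
Qed.

(** Each minor operation is undone on the model: a deleted vertex gets [None], a deleted edge
    changes nothing, and a contracted [b] joins the branch set of [a]. *)
Lemma model_of_minor (H G : sgraph) :
  minor H G -> exists phi : G -> option H, minor_model H G phi.
Proof.
elim=> {G} [G [f [g fK gK] fadj]|G w _ [phi M]|G a b ab _ [phi M]|G a b ab _ [phi M]].
- exists (fun x => Some (f x)); split.
  + by move=> h; exists (g h); rewrite gK.
  + move=> P _ x y h [<-] [E]; suff -> : x = y by [].
    by apply: (can_inj fK); rewrite E.
  + move=> h k hk; exists (g h), (g k); split; rewrite ?gK //.
    by rewrite -fadj !gK.
- exists (fun x => obind phi (insub x)).
  apply: (minor_model_map _ _ _ _ _ (fun x : del_vertex w => val x) M).
  + by move=> x h /=; rewrite valK.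
  + by move=> x y h k _ _ xy; right.
  + by move=> y h; case: insubP => //= x _ <- xh; exists x.
- exists phi; refine (@minor_model_map _ _ G phi phi (fun x : G => x) M _ _ _) => //.
  + by move=> x y h k _ _ /andP[xy _]; right.
  + by move=> y h; exists y.
- case: M => surj conn edge.
  have anb : a != b by apply: contraTneq ab => ->; rewrite adj_irrefl.
  pose a' : contract a b := Sub a anb.
  pose rep x : contract a b := insubd a' x.
  have rep_val (x : contract a b) : rep (val x) = x by rewrite /rep valKd.
  have rep_b : rep b = a' by rewrite /rep /insubd insubF // eqxx.
  have rep_ne x : x != b -> val (rep x) = x by move=> xb; rewrite val_insubd xb.
  exists (fun x => phi (rep x)); split.
  + by move=> h; have [x xh] := surj h; exists (val x); rewrite rep_val.
  + move=> P step x y h xh yh Px.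
    have repa : rep a = a' by exact: (rep_val a').
    have to_b k : phi a' = Some k -> P a -> P b.
      by move=> ak; apply: (step a b k); rewrite ?repa ?rep_b.
    have to_a k : phi a' = Some k -> P b -> P a.
      by move=> ak; apply: (step b a k); rewrite ?repa ?rep_b // adj_sym.
    (* Propagation runs along representatives first; an edge of the contraction inherited from [b]
       is replaced by a detour through the edge between [a] and [b]. Passing between a vertex and
       its representative matters only at [b]. *)
    have Q : P (val (rep y)).
      apply: (conn (fun z => P (val z)) _ (rep x) (rep y) h xh yh) => [s t k sk tk /andP[_]|].
        case/or3P=> [st|/andP[/eqP sa bt]|/andP[/eqP ta bs]].
        - by apply: step st; rewrite rep_val; eassumption.
        - have as' : s = a' by apply: val_inj.
          move=> Ps; apply: (step b (val t) k); rewrite ?rep_b ?rep_val // -?as' //.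
          by apply: (to_b k); rewrite -?as' // -sa.
        - have as' : t = a' by apply: val_inj.
          move=> Ps; rewrite ta; apply: (to_a k); first by rewrite -as'.
          by apply: (step (val s) b k) Ps; rewrite ?rep_b ?rep_val // -?as' // adj_sym.
      have [E|xb] := eqVneq x b; last by rewrite rep_ne.
      by move: xh Px; rewrite E rep_b => /to_a.
    have [E|yb] := eqVneq y b; last by rewrite -(rep_ne y).
    by move: yh Q; rewrite E rep_b => /to_b.
  + move=> h k hk; have [x [y [xh yk /andP[_]]]] := edge h k hk.
    case/or3P=> [st|/andP[/eqP sa bt]|/andP[/eqP ta bs]].
    * by exists (val x), (val y); rewrite !rep_val.
    * exists b, (val y); rewrite rep_val rep_b; split=> //.
      by rewrite -xh; congr phi; apply: val_inj.
    * exists (val x), b; rewrite rep_val rep_b adj_sym; split=> //.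
      by rewrite -yk; congr phi; apply: val_inj.
Qed.

(** Induction on the number of adjacent pairs of [G] that [f] does not send to adjacent pairs of
    [H]: each round deletes one such edge, and when none is left [f] is an isomorphism. *)
Lemma minor_of_spanning (H G : sgraph) (f : G -> H) :
  bijective f -> (forall x y, f x -- f y -> x -- y) -> minor H G.
Proof.
have [k] := ubnP #|[set p : G * G | (p.1 -- p.2) && ~~ (f p.1 -- f p.2)]|.
elim: k G f => // k IH G f; rewrite ltnS => le_k bij_f hom_f.
have [noex|] := boolP [forall x, forall y, (x -- y) ==> (f x -- f y)].
  apply: minor_iso; exists f => // x y; apply/idP/idP; first exact: hom_f.
  by move/forallP/(_ x)/forallP/(_ y)/implyP: noex.
rewrite negb_forall => /existsP[a]; rewrite negb_forall => /existsP[b].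
rewrite negb_imply => /andP[ab fab].
apply: (minor_del_edge ab).
have set2E x y : [set x; y] = [set a; b] -> (f x -- f y) = (f a -- f b).
  move=> E.
  have : a \in [set x; y] by rewrite E set21.
  have : b \in [set x; y] by rewrite E set22.
  have : x \in [set a; b] by rewrite -E set21.
  have : y \in [set a; b] by rewrite -E set22.
  rewrite !in_set2.
  have /negP ab' : a != b by apply: contraTneq ab => ->; rewrite adj_irrefl.
  by do 4![case/orP=> /eqP ?]; subst; rewrite // ?eqxx // in ab' *; rewrite adj_sym.
apply: (IH (del_edges [set [set a; b]]) f) => //.
- apply: leq_trans le_k; apply: proper_card; apply/properP; split.
    by apply/subsetP=> p; rewrite !inE => /andP[/andP[-> _] ->].
  exists (a, b); first by rewrite inE /= ab.
  by rewrite inE /= /del_edges_rel inE eqxx andbF.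
- move=> x y fxy; rewrite /= /del_edges_rel hom_f //= inE.
  by apply: contraNneq fab => /set2E <-.
Qed.

Lemma minor_of_model (H G : sgraph) (phi : G -> option H) :
  minor_model H G phi -> minor H G.
Proof.
have [k] := ubnP #|G|; elim: k G phi => // k IH G phi; rewrite ltnS => le_k M.
have lt_sub (w : G) : (#|{: {z : G | z != w}}| < k)%N.
  rewrite card_sig; apply: leq_trans le_k.
  rewrite [X in (_ < X)%N](cardD1 w) ltnS.
  by apply/subset_leq_card/subsetP => x; rewrite !inE => ->.
case: (M) => surj conn edge.
have [/existsP[w /eqP w0]|/existsPn tot] := boolP [exists w, phi w == None].
  apply: (@minor_del_vertex _ _ w); apply: (IH (del_vertex w) (fun z : del_vertex w => phi (val z))); first exact: lt_sub.
  have ne x h : phi x = Some h -> x != w by move=> xh; apply: contra_eq_neq xh => ->; rewrite w0.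
  split=> [h|P step x y h xh yh Px|h l hl].
  - by have [x xh] := surj h; exists (Sub x (ne _ _ xh)).
  (* [P] lives only on the vertices other than [w]; quantifying over preimages under [val] extends
     it to [G], vacuously at [w]. *)
  - have : forall z, val z = val y -> P z.
      apply: (conn (fun t => forall z, val z = t -> P z) _ (val x) (val y) h xh yh) => [s t l sl tl st Ps z zt|z /val_inj-> //].
      by apply: (step (Sub s (ne _ _ sl)) z l); rewrite ?zt //=; [rewrite /del_vertex_rel zt | exact: Ps].
    exact.
  - have [x [y [xh yk xy]]] := edge h l hl.
    by exists (Sub x (ne _ _ xh)), (Sub y (ne _ _ yk)).
have [/existsP[a /existsP[b /andP[ab /eqP eab]]]|noedge] :=
    boolP [exists a, exists b, (a -- b) && (phi a == phi b)].
  apply: (minor_contract ab); apply: (IH (contract a b) (fun z : contract a b => phi (val z))); first exact: lt_sub.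
  have anb : a != b by apply: contraTneq ab => ->; rewrite adj_irrefl.
  pose a' : contract a b := Sub a anb.
  pose rep x : contract a b := insubd a' x.
  have repE x : val (rep x) = if x == b then a else x.
    by rewrite val_insubd; case: eqVneq.
  apply: (minor_model_map _ _ _ _ _ rep M).
  - by move=> x h xh; rewrite repE; case: eqVneq xh => // ->; rewrite eab.
  - move=> x y _ _ _ _ xy; have [|ne] := eqVneq (rep x) (rep y); [by left | right].
    rewrite /= /contract_rel ne !repE.
    have [xb|xb] := eqVneq x b; have [yb|yb] := eqVneq y b.
    + by rewrite xb yb adj_irrefl in xy.
    + by rewrite xb in xy; rewrite eqxx xy orbT.
    + by rewrite yb adj_sym in xy; rewrite eqxx xy !orbT.
    + by rewrite xy.
  - move=> y h yh; exists (val y) => //; apply: val_inj; rewrite repE.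
    by rewrite (negPf (valP y)).
(* With no edge inside a fibre, every predicate propagates vacuously; taking [eq x] shrinks the
   fibre to a point. *)
have inj x y h : phi x = Some h -> phi y = Some h -> x = y.
  move=> xh yh; apply: (conn (eq x) _ x y h) => // s t l sl tl st.
  move/existsPn/(_ s)/existsPn/(_ t): noedge.
  by rewrite st sl tl eqxx.
have [f fE] : exists f : G -> H, forall x, phi x = Some (f x).
  have ex x : exists h, phi x == Some h.
    by move: (tot x); case: (phi x) => // h _; exists h.
  by exists (fun x => xchoose (ex x)) => x; apply/eqP/(xchooseP (ex x)).
apply: (minor_of_spanning _ _ f).
- have ex h : exists x, f x == h.
    by have [x] := surj h; rewrite fE => -[<-]; exists x.
  exists (fun h => xchoose (ex h)) => [x|h]; last exact/eqP/(xchooseP (ex h)).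
  apply: (inj _ _ (f x)); rewrite fE ?(eqP (xchooseP (ex (f x)))) //.
- move=> x y /edge[x' [y' [xx' yy' ]]].
  by rewrite (inj x' x (f x)) // (inj y' y (f y)).
Qed.

(** * A configuration that forces a [complete_minus2] minor *)

(* [K_r^=] is the join of [K_(r-3)], realised here by [A], with the disjoint
   union of a vertex, realised by [c], and an edge, realised by [{b, w}, d]. *)
Lemma complete_minus2_minor (r : nat) (G : sgraph) (A : {set G}) (b c d w : G) :
  (3 <= r)%N -> #|A| = (r - 3)%N ->
  (forall x y, x \in A -> y \in A -> x != y -> x -- y) ->
  (forall x y, x \in A -> y \in [set b; c; d] -> x -- y) ->
  uniq [:: c; b; d] -> w \notin A -> w != c ->
  w = b \/ b -- w -> w -- d ->
  minor (complete_minus2 r) G.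
Proof.
move=> r3 cardA cliqueA joinA uniq3 wA wc wb wd.
(* The order matters: [c] gets index 0, the vertex with two missing edges, [b] and [d] get 1 and 2,
   and [A] fills the indices from 3 on. *)
pose s := [:: c; b; d] ++ enum A.
have memA x : x \in A -> x \notin [:: c; b; d].
  move=> xA; apply/negP => xs; suff : x -- x by rewrite adj_irrefl.
  by apply: joinA => //; move: xs; rewrite !inE => /or3P[] ->; rewrite ?orbT.
have size_s : size s = r by rewrite size_cat -cardE cardA /=; lia.
have uniq_s : uniq s.
  rewrite cat_uniq uniq3 enum_uniq andbT; apply/hasPn => x.
  by rewrite mem_enum => /memA.
have wd' : w != d by apply: contraTneq wd => ->; rewrite adj_irrefl.
have ws : w \in s -> w = b.
  rewrite mem_cat mem_enum (negPf wA) orbF !inE (negPf wc) (negPf wd') orbF.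
  by move/eqP.
pose rho x := if x == w then b else x.
(* A vertex with [rho x] outside [s] has index [size s], which is [r], so [insub] yields [None]; [w]
   shares the label of [b]. *)
pose phi (x : G) : option (complete_minus2 r) := insub (index (rho x) s).
pose e (i : 'I_r) := nth c s i.
have es i : e i \in s by apply: mem_nth; rewrite size_s.
have rho_s x : x \in s -> rho x = x.
  by rewrite /rho; have [-> /ws|] := eqVneq x w.
have phi_e i : phi (e i) = Some i.
  by rewrite /phi rho_s // index_uniq ?size_s // valK.
have phiE x i : phi x = Some i -> rho x = e i.
  rewrite /phi; case: insubP => //= j xr jE [<-]; rewrite /e jE nth_index //.
  by rewrite -index_mem size_s.
have phi_w (i : 'I_r) : i = 1%N :> nat -> phi w = Some i.
  move=> i1; rewrite /phi /rho eqxx (_ : b = e i); last by rewrite /e i1.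
  by rewrite index_uniq ?size_s // valK.
have e_ge3 (i : 'I_r) : (3 <= i)%N -> e i \in A.
  move=> i3; have := ltn_ord i => ir.
  by rewrite /e nth_cat ltnNge i3 -mem_enum mem_nth // -cardE cardA /=; lia.
apply: (minor_of_model _ _ phi); split.
- by move=> i; exists (e i).
- move=> P step x y i xi yi.
  have : rho x = rho y by rewrite (phiE _ _ xi) (phiE _ _ yi).
  rewrite /rho; have [xw|xw] := eqVneq x w; have [yw|yw] := eqVneq y w.
  + by rewrite xw yw.
  + case: wb => [<- <-|bw bE]; first by rewrite xw.
    by apply: (step _ _ i) => //; rewrite xw -bE adj_sym.
  + case: wb => [<- ->|bw bE]; first by rewrite yw.
    by apply: (step _ _ i) => //; rewrite yw bE.
  + by move=> ->.
- suff main (i j : complete_minus2 r) : i -- j -> ((i : 'I_r) < (j : 'I_r))%N ->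
      exists x y, [/\ phi x = Some i, phi y = Some j & x -- y].
    move=> i j ij; have [lt_ij|lt_ji|E] := ltngtP (i : 'I_r) (j : 'I_r).
    + exact: main.
    + rewrite adj_sym in ij; have [x [y [xj yi xy]]] := main j i ij lt_ji.
      by exists y, x; rewrite adj_sym.
    + by move: ij; rewrite (val_inj E) adj_irrefl.
  move=> ij lt_ij.
  have [j3|j3] := leqP 3 (j : 'I_r).
    exists (e i), (e j); split=> //; have ejA := e_ge3 j j3.
    have [i3|i3] := leqP 3 (i : 'I_r).
      by apply: cliqueA => //; rewrite ?e_ge3 // nth_uniq ?size_s //; lia.
    rewrite adj_sym joinA // /e.
    by case: (i : 'I_r) i3 => -[|[|[|k]]] // ? _; rewrite /= !inE eqxx ?orbT.
  (* Both labels are now below 3, and the edges from 0 to 1 and 2 are the missing ones. Only the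
     pair of 1 and 2 survives, realised by [w -- d]. *)
  have i0 : (i : 'I_r) != 0%N :> nat.
    apply: contraL ij => i0; rewrite /= /del_edges_rel negb_and negbK; apply/orP; right.
    by apply: imset2_f; rewrite inE //; lia.
  have i1 : (i : 'I_r) = 1%N :> nat by lia.
  have j2 : (j : 'I_r) = 2%N :> nat by lia.
  by exists w, (e j); split; [exact: phi_w | exact: phi_e | rewrite /e j2].
Qed.

(** * Adjacency in the rewired graph *)

(** A pair containing [u] determines its other end, and a pair avoiding [u] lies in neither edge
    set. On the diagonal at [u], the value is false because [u] is outside [A]. *)
Lemma adj_rewire (G : sgraph) (u : G) (A : {set G}) (x y : G) : u \notin A ->
  @adj (rewire u A) x y =
    if x == u then y \in A else if y == u then x \in A else x -- y.
Proof.
move=> uA.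
have inE1 (M : {set G}) z : ([set u; z] \in [set [set u; v] | v in M]) = (z \in M).
  apply/imsetP/idP=> [[v vM E]|zM]; last by exists z.
  have [zu|zu] := eqVneq z u.
    have : v \in [set u; z] by rewrite E set22.
    by rewrite zu !inE orbb => /eqP <-.
  have : z \in [set u; v] by rewrite -E set22.
  by rewrite !inE (negPf zu) => /eqP ->.
have inE0 (M : {set G}) s t : s != u -> t != u ->
    [set s; t] \in [set [set u; v] | v in M] = false.
  move=> su tu; apply/imsetP=> -[v _ E].
  have : u \in [set s; t] by rewrite E set21.
  by rewrite !inE eq_sym (negPf su) eq_sym (negPf tu).
rewrite /= /add_edges_rel /= /del_edges_rel.
have [->|xu] := eqVneq x u.
  rewrite !inE1 inE andbN /=; have [<-|//] := eqVneq u y.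
  by rewrite (negPf uA).
have [->|yu] := eqVneq y u.
  by rewrite xu setUC !inE1 inE adj_sym andbN.
rewrite !inE0 // orbF andbT; have [->|//] := eqVneq x y.
by rewrite adj_irrefl.
Qed.

(** * Twins in [B], and their use in place of [u] *)

Lemma exists_third (T : finType) (B : {set T}) (x y : T) :
  (3 <= #|B|)%N -> exists2 z, z \in B & z \notin [set x; y].
Proof.
move=> B3; have /set0Pn[z] : B :\: [set x; y] != set0.
  rewrite -card_gt0; have := cardsID [set x; y] B.
  have := subset_leq_card (subsetIr B [set x; y]); have := cards2 x y.
  by case: (x != y) => /=; lia.
by rewrite inE => /andP[]; exists z.
Qed.

(** A third vertex of [B] serves as the isolated part of the configuration; extra edges at it are
    harmless, since a minor may drop edges. The second conclusion is what makes a choice of outer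
    neighbours injective. *)
Lemma private_outer_neighbor (r : nat) (G : sgraph) (A B : {set G}) (b w : G) :
  (3 <= r)%N -> minor_free (complete_minus2 r) G -> #|A| = (r - 3)%N ->
  [disjoint A & B] ->
  (forall x y, x \in A -> y \in A -> x != y -> x -- y) ->
  (forall x y, x \in A -> y \in B -> x -- y) ->
  (3 <= #|B|)%N -> b \in B -> w \notin A -> b -- w ->
  w \notin B /\ forall b', b' \in B -> b' -- w -> b' = b.
Proof.
move=> r3 free cardA disAB cliqueA joinAB B3 bB wA bw.
have join3 c d : c \in B -> d \in B ->
    forall x y, x \in A -> y \in [set b; c; d] -> x -- y.
  move=> cB dB x y xA; rewrite !inE => /orP[/orP[]|] /eqP->; exact: joinAB.
have wB : w \notin B.
  apply/negP => wB; have [c cB] := exists_third _ B b w B3.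
  rewrite !inE negb_or => /andP[cb cw].
  have bA : b \notin A by apply: contraL bB => /(disjointFr disAB)->.
  (* The required edge is [b -- w] itself: [w] takes the place of [d], and nothing is merged with
     [b]. *)
  apply: free; apply: (complete_minus2_minor r G A b c w b) => //.
  - exact: join3.
  - rewrite /= !inE negb_or cb cw /= andbT.
    by apply: contraTneq bw => ->; rewrite adj_irrefl.
  - by rewrite eq_sym.
  - by left.
split=> // d dB dw; apply/eqP/negPn/negP => db.
have [c cB] := exists_third _ B b d B3; rewrite !inE negb_or => /andP[cb cd].
(* Here [w] is merged into the branch set of [b], which makes it adjacent to that of [d]. *)
apply: free; apply: (complete_minus2_minor r G A b c d w) => //.
- exact: join3.
- by rewrite /= !inE negb_or cb cd /= eq_sym db.
- by apply: contraNneq wB => ->.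
- by right.
- by rewrite adj_sym.
Qed.

(** Picking an outer neighbour for each remaining vertex of [B] injects these vertices into the
    complement of [B]. Hence at least [2 * #|B| - #|G|] vertices are counted. *)
Lemma card_neighborhood_eq (r : nat) (G : sgraph) (A B : {set G}) :
  (3 <= r)%N -> minor_free (complete_minus2 r) G -> #|A| = (r - 3)%N ->
  [disjoint A & B] ->
  (forall x y, x \in A -> y \in A -> x != y -> x -- y) ->
  (forall x y, x \in A -> y \in B -> x -- y) ->
  (3 <= #|B|)%N -> (r + #|G| < 2 * #|B|)%N ->
  (r < #|[set b in B | neighborhood b == A]|)%N.
Proof.
move=> r3 free cardA disAB cliqueA joinAB B3 big.
set I := [set b in B | _].
have outP b : b \in B :\: I -> exists2 w, w \notin A & b -- w.
  rewrite !inE => /andP[+ bB]; rewrite bB /= eqEsubset negb_and.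
  case/orP=> /subsetPn[w]; rewrite inE; first by exists w.
  by move=> wA; rewrite adj_sym joinAB.
pose out b := odflt b [pick w | (w \notin A) && (b -- w)].
have outE b : b \in B :\: I -> out b \notin A /\ b -- out b.
  rewrite /out => /outP[w wA bw]; case: pickP => [w' /andP[]//|/(_ w)].
  by rewrite wA bw.
have priv b : b \in B :\: I ->
    out b \notin B /\ forall b', b' \in B -> b' -- out b -> b' = b.
  move=> bI; have [oA bo] := outE b bI.
  apply: (private_outer_neighbor r G A B b) => //.
  by case/setDP: bI.
have inj : {in B :\: I &, injective out}.
  move=> b b' bI b'I E; have [_ uniq_b'] := priv b' b'I.
  apply: uniq_b'; first by case/setDP: bI.
  by rewrite -E; case: (outE b bI).
have sub : out @: (B :\: I) \subset ~: B.
  by apply/subsetP=> _ /imsetP[b bI ->]; rewrite inE; case: (priv b bI).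
have := subset_leq_card sub; rewrite (card_in_imset inj).
have := cardsC B; have := cardsID I B; have := subset_leq_card (subsetIr B I).
lia.
Qed.

Theorem theorem4p3 (R : realFieldType) (r n : nat) (G : sgraph)
    (A B : {set G}) (delta : R)
    (hr : (4 <= r)%N)
    (hn : #|G| = n)
    (hG : minor_free (complete_minus2 r) G)
    (hAB : [disjoint A & B])
    (hA : #|A| = (r - 3)%N)
    (hdelta : 0 <= delta)
    (hB : #|B|%:R = (1 - delta) * n%:R)
    (hnr : r%:R < (1 - 2 * delta) * n%:R)
    (hcliqueA : forall x y : G, x \in A -> y \in A -> x != y -> x -- y)
    (hjoinAB : forall x y : G, x \in A -> y \in B -> x -- y)
    (u : G) (hu : u \notin A :|: B) :
  minor_free (complete_minus2 r) (rewire u A).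
Proof.
(* Doubling [hB] gives [n + (1 - 2 * delta) * n], whose second term exceeds [r] by [hnr]. *)
have big : (r + #|G| < 2 * #|B|)%N.
  by rewrite hn -(ltr_nat R) natrD natrM hB; lra.
have B3 : (3 <= #|B|)%N by lia.
have r3 : (3 <= r)%N by lia.
have bigI := card_neighborhood_eq r G A B r3 hG hA hAB hcliqueA hjoinAB B3 big.
set I := [set b in B | _] in bigI.
have [uA uB] : u \notin A /\ u \notin B.
  by move: hu; rewrite inE negb_or => /andP[].
have nbrI b : b \in I -> forall x, b -- x = (x \in A).
  by rewrite inE => /andP[_ /eqP <-] x; rewrite inE.
have I_B b : b \in I -> b \in B by rewrite inE => /andP[].
have I_A b : b \in I -> b \notin A.
  by move/I_B; apply: contraL => /(disjointFr hAB)->.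
have I_u b : b \in I -> b != u by move/I_B; apply: contraTneq => ->.
move=> /model_of_minor[phi M].
(* Two of the more than [r] twins in [I] lie in the same branch set unless one
   of them, [b], is unused; in the former case [b] is redundant beside its twin
   [c]. Either way [b] can take over the role of [u]. *)
have [b [c [bI cI twin]]] : exists b c, [/\ b \in I, c \in I &
    phi b = None \/ (c != b /\ phi c = phi b)].
  have [/exists_inP[b bI /eqP b0]|/exists_inPn used] :=
      boolP [exists b in I, phi b == None].
    by exists b, b; split=> //; left.
  have /dinjectivePn[b bI [c]] : ~~ dinjectiveb phi I.
    apply: contraL bigI => /dinjectiveP/card_in_imset <-; rewrite -leqNgt.
    have : phi @: I \subset Some @: [set: complete_minus2 r].
      apply/subsetP => _ /imsetP[x xI ->]; move: (used x xI).
      by case: (phi x) => // i _; apply: imset_f; rewrite inE.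
    move/subset_leq_card/leq_trans; apply.
    by apply: leq_trans (leq_imset_card _ _) _; rewrite cardsT card_ord.
  case/predD1P=> /eqP cb cI E; exists b, c; split=> //; right; split=> //.
pose rho x := if x == b then c else if x == u then b else x.
pose psi x := if x == b then phi u else if x == u then None else phi x.
apply: hG; apply: (minor_of_model _ _ psi).
apply: (minor_model_map _ (rewire u A) G phi psi rho M).
- move=> x i xi; rewrite /psi /rho.
  have [xb|xb] := eqVneq x b.
    rewrite xb in xi; case: twin => [b0|[cb cE]]; first by rewrite b0 in xi.
    by rewrite (negPf cb) (negPf (I_u c cI)) cE.
  have [xu|xu] := eqVneq x u; first by rewrite eqxx -xu.
  by rewrite (negPf xb) (negPf xu).
(* Edges survive because [u] in the rewired graph has neighborhood [A], as do [b] and [c] in [G],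
   while [rho] fixes [A] pointwise. *)
- have adjA x y : x \in A -> y \in I -> x -- y by move=> xA yI; rewrite adj_sym nbrI.
  move=> x y _ _ _ _; rewrite adj_rewire // => xy; right; move: xy; rewrite /rho.
  have ub : (u == b) = false by rewrite eq_sym (negPf (I_u b bI)).
  have [->|xu] := eqVneq x u; [|have [->|yu] := eqVneq y u].
  + rewrite ub => yA.
    have -> : (y == b) = false
      by apply: contraNF (I_A b bI) => /eqP <-.
    have -> : (y == u) = false by apply: contraNF uA => /eqP <-.
    by rewrite nbrI.
  + rewrite ub => xA.
    have -> : (x == b) = false
      by apply: contraNF (I_A b bI) => /eqP <-.
    exact: adjA.
  + have [->|xb] := eqVneq x b; have [->|yb] := eqVneq y b => //.
    * by rewrite adj_irrefl.
    * by rewrite !nbrI.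
    * by rewrite adj_sym nbrI // => /adjA->.
- move=> y i; rewrite /psi /rho.
  have [->|yb] := eqVneq y b.
    by move=> ui; exists u => //; rewrite eq_sym (negPf (I_u b bI)) eqxx.
  have [//|yu] := eqVneq y u.
  by move=> yi; exists y => //; rewrite (negPf yb) (negPf yu).
Qed.
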